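(* Let $n\ge1$ and let $H:\mathbb{R}^n\to\mathbb{R}$ be a function. The following are equivalent: (i) $H$ is a continuous conservative statistic; (ii) $H$ is a selector; (iii) $H$ is a Sperner statistic.
   Context: A Borel measurable function $H:\mathbb{R}^n\to\mathbb{R}$ is a conservative statistic if there is a function $h:[0,1]\to[0,1]$ such that for every real random variable $X$, with independent copies $X_1,\dots,X_n$ of $X$, one has $\mathbf{P}(H(X_1,\dots,X_n)\le t)=h(\mathbf{P}(X\le t))$ for every $t\in\mathbb{R}$. A selector is a continuous function $H:\mathbb{R}^n\to\mathbb{R}$ such that $H(x_1,\dots,x_n)\in\{x_1,\dots,x_n\}$ for every $(x_1,\dots,x_n)\in\mathbb{R}^n$. A Sperner family in $\{1,\dots,n\}$ is a collection $\{A_1,\dots,A_k\}$, $k\ge 1$, of nonempty subsets of $\{1,\dots,n\}$ such that no $A_i$ is contained in another $A_j$. A Sperner statistic is a function of the form $H(x_1,\dots,x_n)=\max_{1\le j\le k}\min_{i\in A_j}x_i$ for some Sperner family $\{A_1,\dots,A_k\}$ in $\{1,\dots,n\}$. *)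

(* Defs.v *)
From HB Require Import structures.
From mathcomp Require Import all_boot all_order all_algebra.
From mathcomp Require Import all_classical all_reals all_analysis.

Set Implicit Arguments.
Unset Strict Implicit.
Unset Printing Implicit Defensive.

Import Order.TTheory GRing.Theory Num.Theory numFieldNormedType.Exports.

Local Open Scope classical_set_scope.
Local Open Scope ring_scope.

Definition mutually_independent d (T : measurableType d) (R : realType)
    (P : probability T R) n (X : 'I_n -> {RV P >-> R}) : Prop :=
  forall (J : {set 'I_n}) (B : 'I_n -> set R),
    (forall i, measurable (B i)) ->
    P (\bigcap_(i in [set` J]) (X i @^-1` B i)) =
      (\prod_(i in J) P (X i @^-1` B i))%E.

(* The copies may live on another probability space than X itself. *)
Definition independent_copies d0 (T0 : measurableType d0) (R : realType)
    (P0 : probability T0 R) (X : {RV P0 >-> R})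
    d (T : measurableType d) (P : probability T R)
    n (Xs : 'I_n -> {RV P >-> R}) : Prop :=
  mutually_independent Xs /\
  forall (i : 'I_n) (B : set R), measurable B ->
    distribution P (Xs i) B = distribution P0 X B.

(* 'rV[R]_n carries no canonical sigma-algebra, so the Borel one, generated by
   the open sets, is put on it explicitly. *)
Definition borel_measurable (R : realType) n (H : 'rV[R]_n -> R) : Prop :=
  measurable_fun [set: g_sigma_algebraType (@open 'rV[R]_n)]
    (H : g_sigma_algebraType (@open 'rV[R]_n) -> R).

(* A function from [0, 1] to [0, 1] is encoded as a function h on R that maps
   `[0, 1] into itself; its values elsewhere are irrelevant. *)
Definition conservative_statistic (R : realType) n (H : 'rV[R]_n -> R) : Prop :=
  borel_measurable H /\
  exists h : R -> R,
    (forall p, 0 <= p <= 1 -> 0 <= h p <= 1) /\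
    forall d0 (T0 : measurableType d0) (P0 : probability T0 R)
      (X : {RV P0 >-> R})
      d (T : measurableType d) (P : probability T R)
      (Xs : 'I_n -> {RV P >-> R}),
      independent_copies X Xs ->
      forall t : R,
        P [set w | H (\row_i Xs i w) <= t] =
          (h (fine (P0 [set w | X w <= t])))%:E.

Definition selector (R : realType) n (H : 'rV[R]_n -> R) : Prop :=
  continuous H /\ forall x : 'rV[R]_n, exists i : 'I_n, H x = x ord0 i.

Definition sperner_family n (F : {set {set 'I_n}}) : Prop :=
  [/\ F != finset.set0,
      forall A, A \in F -> A != finset.set0
    & forall A B, A \in F -> B \in F -> A \subset B -> A = B].

(* The max and min are taken in the extended reals, which supply the neutral
   elements -oo and +oo. As a Sperner family is nonempty and so are its members,
   the value is finite and is the max-min of the coordinates. *)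
Definition sperner_statistic (R : realType) n (H : 'rV[R]_n -> R) : Prop :=
  exists F : {set {set 'I_n}}, sperner_family F /\
    forall x : 'rV[R]_n,
      (H x)%:E = \big[Order.max/-oo%E]_(A in F)
                   \big[Order.min/+oo%E]_(i in A) (x ord0 i)%:E.

(* Main.v *)
From HB Require Import structures.
Require Import Defs.
From mathcomp Require Import all_boot all_order all_algebra.
From mathcomp Require Import all_classical all_reals all_analysis.
From mathcomp Require Import lra.
Import Order.TTheory GRing.Theory Num.Theory.
Import numFieldNormedType.Exports.

Set Implicit Arguments.
Unset Strict Implicit.
Unset Printing Implicit Defensive.

Local Open Scope ring_scope.

(** Everything is read off the sets [exceed x t] of coordinates of [x] that lie
    above a level [t].  Call [H] a level rule when a predicate [P] on sets of
    indices decides [t < H x] from [exceed x t] alone.  Each of the three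
    conditions is tied to this one.

    A conservative statistic picks a coordinate, continuous or not.  Given [x],
    let [X] be [x i] for a uniformly random index [i], and let the copies of [X]
    come from independent draws of indices.  The distribution function of [X] is
    constant just below any level [t] that is not a coordinate of [x], hence so
    is that of [H] of the copies.  But with positive probability the copies
    reproduce [x] itself, so the latter jumps at [t = H x].  Hence [H x] is a
    coordinate ([conservative_coord]).

    A selector is a level rule.  Move [x] and [t] along segments to the
    indicator vector of [exceed x t] and to [1/2].  No coordinate ever meets the
    moving level, so neither does [H], and by the intermediate value theorem [H]
    stays on the same side of it ([selector_level_rule]).

    A level rule has a monotone [P], false on the empty set and true on the full
    one.  Monotonicity makes [H] 1-Lipschitz for the sup norm, and [H x] is a
    coordinate because [exceed x] jumps only at coordinates
    ([level_rule_selector]).  The minimal sets satisfying [P] form a Sperner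
    family whose statistic is [H] ([level_rule_sperner]), and conversely a
    Sperner statistic is a level rule for the predicate of containing a member
    of the family.  Finally, for independent copies the indices above [t] form a
    random set whose law depends on [P(X <= t)] only, whence conservativity
    ([level_rule_conservative]). *)

(** * Level rules *)

Definition exceed (R : realType) n (x : 'rV[R]_n) (t : R) : {set 'I_n} :=
  [set i | t < x ord0 i]%SET.

(** [H] extends the Boolean function [P] from indicator vectors to real ones,
    one level at a time. *)
Definition level_rule (R : realType) n (H : 'rV[R]_n -> R)
    (P : pred {set 'I_n}) : Prop :=
  forall x t, (t < H x) = P (exceed x t).

Section Threshold.
Context (R : realType) (n : nat).
Implicit Types (H : 'rV[R]_n -> R) (P : pred {set 'I_n}) (x y : 'rV[R]_n).

Lemma coord_isolated x (t : R) :
  exists2 e, 0 < e & forall i, `|x ord0 i - t| < e -> x ord0 i = t.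
Proof.
exists (\big[Order.min/1]_(i | x ord0 i != t) `|x ord0 i - t|).
  apply/bigmin_gtP; split=> // i xit.
  by rewrite normr_gt0 subr_eq0.
move=> i; apply: contraPP => /eqP xit; rewrite ltNge.
by apply/negP/negPn; exact: bigmin_le_cond.
Qed.

(** As [t] decreases from a value that is not a coordinate, no coordinate is
    crossed at first. *)
Lemma coord_of_exceed_jump x t :
  (forall u, u < t -> exceed x u != exceed x t) -> exists i, t = x ord0 i.
Proof.
move=> jump; have [/existsP[i /eqP ->]|/existsPn noi] :=
  boolP [exists i, t == x ord0 i]; first by exists i.
have [e e0 he] := coord_isolated x t.
have /negP[] := jump (t - e / 2) ltac:(lra).
apply/eqP/setP => i; rewrite !inE; apply/idP/idP; last by lra.
move=> ui; rewrite ltNge; apply/negP => ti.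
have := noi i; rewrite he ?eqxx// ltr_norml; lra.
Qed.

Lemma level_rule_coord H P :
  level_rule H P -> forall x, exists i, H x = x ord0 i.
Proof.
move=> HP x; apply: coord_of_exceed_jump => u ux.
by apply/eqP => same; have := HP x (H x); rewrite ltxx -same -HP ux.
Qed.

(** For [A] inside [B], a vector equal to 2 on [A], to 1 on the rest of [B] and
    to 0 elsewhere has both sets among its [exceed] sets, [B] at the lower
    level. *)
Lemma level_rule_mono H P : level_rule H P ->
  forall A B : {set 'I_n}, A \subset B -> P A -> P B.
Proof.
move=> HP A B /fintype.subsetP AB PA.
pose x : 'rV[R]_n := \row_i ((i \in A)%:R + (i \in B)%:R).
have eA : exceed x (3 / 2) = A.
  apply/setP => i; rewrite !inE mxE.
  case: (boolP (i \in A)) => [/AB ->|_]; case: (i \in B) => /=;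
    by apply/idP/idP; lra.
have eB : exceed x (1 / 2) = B.
  apply/setP => i; rewrite !inE mxE.
  case: (boolP (i \in A)) => [/AB ->|_]; try case: (i \in B) => /=;
    by apply/idP/idP; lra.
by rewrite -eB -HP; apply: (@lt_trans _ _ (3 / 2)); [lra | rewrite HP eA].
Qed.

(** Both monotonicity and translation by a constant enter here; exchanging [x]
    and [y] makes [H] 1-Lipschitz for the sup norm. *)
Lemma level_rule_le H P : level_rule H P -> forall x y (e : R),
  (forall i, y ord0 i <= x ord0 i + e) -> H y <= H x + e.
Proof.
move=> HP x y e yx; rewrite leNgt HP; apply/negP => Py.
suff : H x < H x by rewrite ltxx.
rewrite [X in is_true X]HP; apply: level_rule_mono HP _ _ _ Py.
by apply/fintype.subsetP => i; rewrite !inE; have := yx i; lra.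
Qed.

Lemma level_rule_continuous H P : level_rule H P -> continuous H.
Proof.
move=> HP x; apply/(@cvgrPdist_le _ _ _ _ (nbhs_filter x)) => /= e e0.
have nx : \forall y \near x, forall i, `|x ord0 i - (y : 'rV[R]_n) ord0 i| <= e.
  apply: (@filter_forall _ _ _ (nbhs x) (nbhs_filter x)) => i.
  have ci : ((fun y : 'rV[R]_n => y ord0 i) @ x --> x ord0 i)%classic.
    exact: coord_continuous.
  by move/(@cvgrPdist_le _ _ _ _ (nbhs_filter x)) : ci; exact.
apply: filterS nx => y xy; rewrite ler_distlC; apply/andP; split.
  rewrite lerBlDr; apply: (level_rule_le HP) => i.
  by have := xy i; rewrite ler_distl; lra.
by apply: (level_rule_le HP) => i; have := xy i; rewrite ler_distl; lra.
Qed.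

Lemma level_rule_selector H P : level_rule H P -> selector H.
Proof.
move=> HP; split; first exact: level_rule_continuous HP.
exact: level_rule_coord HP.
Qed.

Lemma level_rule_set0 H P : level_rule H P -> P finset.set0 = false.
Proof.
move=> HP; have <- : exceed (0 : 'rV[R]_n) (Num.max 0 (H 0)) = finset.set0.
  by apply/setP => i; rewrite !inE mxE gt_max ltxx.
by rewrite -HP gt_max ltxx andbF.
Qed.

Lemma level_rule_setT H P : level_rule H P -> P [set: 'I_n]%SET.
Proof.
move=> HP.
have <- : exceed (0 : 'rV[R]_n) (Num.min 0 (H 0) - 1) = [set: 'I_n]%SET.
  by apply/setP => i; rewrite !inE mxE; rewrite ltrBlDr gt_min ltr_pwDr.
by rewrite -HP ltrBlDr gt_min (@ltrDl _ (H 0) 1) ltr01 orbT.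
Qed.

(** * Sperner statistics *)

Lemma sperner_bigmaxE (F : {set {set 'I_n}}) x (t : R) :
  (t%:E < \big[Order.max/-oo]_(A in F) \big[Order.min/+oo]_(i in A)
     (x ord0 i)%:E)%E = [exists A in F, A \subset exceed x t].
Proof.
apply/bigmax_gtP/exists_inP =>
  [[//|[A AF /bigmin_gtP[_ At]]]|[A AF /fintype.subsetP At]].
  by exists A => //; apply/fintype.subsetP => i /At; rewrite inE lte_fin.
right; exists A => //; apply/bigmin_gtP; split=> [|i /At]; first exact: ltry.
by rewrite inE lte_fin.
Qed.

Lemma sperner_level_rule H : sperner_statistic H -> exists P, level_rule H P.
Proof.
move=> [F [_ HF]].
exists (fun B : {set 'I_n} => [exists A in F, A \subset B]) => x t.
by rewrite -lte_fin HF sperner_bigmaxE.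
Qed.

(** The minimal sets satisfying [P] are pairwise incomparable, and by
    monotonicity [P] holds exactly of the sets that contain one of them. *)
Lemma level_rule_sperner H P : level_rule H P -> sperner_statistic H.
Proof.
move=> HP; exists [set A | minset P A]%SET; split.
  split=> [|A|A B].
  - have [A mA _] := minset_exists (level_rule_setT HP).
    by apply/finset.set0Pn; exists A; rewrite inE.
  - rewrite inE => /minsetP[PA _]; apply/eqP => A0.
    by move: PA; rewrite A0 (level_rule_set0 HP).
  - by rewrite !inE => /minsetP[PA _] /minsetP[_ mB] AB; exact: mB.
move=> x.
set m := (RHS).
(* An extended real is determined by the reals below it. *)
have Hm t : (t%:E < (H x)%:E)%E = (t%:E < m)%E.
  rewrite lte_fin HP sperner_bigmaxE; apply/idP/exists_inP => [Px|[A]].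
    by have [A mA As] := minset_exists Px; exists A; rewrite ?inE.
  by rewrite inE => /minsetP[PA _] As; apply: level_rule_mono HP _ _ As PA.
case: (m) Hm => [r| |] Hm.
- by apply/eqP; rewrite eq_le !leNgt Hm -(Hm (H x)) !ltxx.
- by have := Hm (H x); rewrite ltry lte_fin ltxx.
- by have := Hm (H x - 1); rewrite [RHS]ltNge leNye lte_fin ltrBlDr ltrDl ltr01.
Qed.

(** * Selectors are level rules *)

Definition indicator (A : {set 'I_n}) : 'rV[R]_n := \row_i (i \in A)%:R.

Lemma nonvanishing_sign (g : R -> R) : continuous g ->
  (forall s, 0 <= s <= 1 -> g s != 0) -> (0 < g 0) = (0 < g 1).
Proof.
move=> cg gn.
have nov : ~ Num.min (g 0) (g 1) <= 0 <= Num.max (g 0) (g 1).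
  move=> g01; have [|s s01] := IVT ler01 _ g01.
    exact: continuous_subspaceT.
  by apply/eqP/gn; rewrite in_itv in s01.
have g0 : g 0 != 0 by apply: gn; lra.
have g1 : g 1 != 0 by apply: gn; lra.
apply/idP/idP => h; rewrite lt_neqAle eq_sym ?g0 ?g1 /= leNgt; apply/negP => h';
  apply: nov; rewrite ge_min le_max (ltW h) (ltW h') ?orbT //.
Qed.

(** When [t] is not a coordinate, the coordinates and the level deform together
    to the indicator vector of [exceed x t] and to [1/2] without ever meeting.
    When it is, [t] is first raised slightly, which changes neither
    [exceed x t] nor, [H x] being a coordinate, the truth of [t < H x]. *)
Lemma selector_level_rule H : selector H ->
  level_rule H (fun A => 1 / 2 < H (indicator A)).
Proof.
move=> [cH Hx].
have main x t : (forall i, x ord0 i != t) ->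
    (t < H x) = (1 / 2 < H (indicator (exceed x t))).
  move=> xt; set y := indicator _.
  pose z (s : R) : 'rV[R]_n := x + s *: (y - x).
  pose g (s : R) := H (z s) - (t + s * (1 / 2 - t)).
  have cg : continuous g.
    move=> s; apply: cvgB; last first.
      by apply: cvgD; [exact: cvg_cst|apply: cvgMl; exact: cvg_id].
    apply: (@continuous_comp _ _ _ z H s); last exact: cH.
    by apply: cvgD; [exact: cvg_cst|apply: cvgZl; exact: cvg_id].
  have gn s : 0 <= s <= 1 -> g s != 0.
    move=> s01; rewrite /g; have [i ->] := Hx (z s).
    (* Each coordinate minus the level is a convex combination of two numbers
       of the same strict sign. *)
    rewrite !mxE inE; have := xt i.
    have [->|s1] := eqVneq s 1.
      by case: ltgtP => // it _ /=; apply/eqP; lra.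
    have {}s1 : 0 < 1 - s by rewrite subr_gt0 lt_neqAle s1; lra.
    case: ltgtP => // it _ /=; apply/eqP; move: it.
      by rewrite -subr_gt0 => /(mulr_gt0 s1); lra.
    by rewrite -subr_gt0 => /(mulr_gt0 s1); lra.
  have := nonvanishing_sign cg gn.
  rewrite /g /z scale0r addr0 mul0r addr0 subr_gt0 => ->.
  by rewrite scale1r mul1r (addrC x) subrK (addrC t) subrK subr_gt0.
move=> x t.
have [e e0 he] := coord_isolated x t.
have xe : exceed x (t + e / 2) = exceed x t.
  apply/setP => i; rewrite !inE; apply/idP/idP; first by lra.
  move=> ti; rewrite ltNge; apply/negP => it.
  have := he i; rewrite ltr_norml; lra.
have tH i : (t + e / 2 < x ord0 i) = (t < x ord0 i).
  by move/setP: xe => /(_ i); rewrite !inE.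
have [i Hi] := Hx x.
rewrite -xe -main ?Hi ?tH// => j; apply/eqP => xj.
by have := tH j; rewrite xj ltxx; lra.
Qed.
End Threshold.

Local Open Scope classical_set_scope.

(** * Level rules are conservative *)

Section Conservative.
Context (R : realType) (n : nat).
Implicit Types (H : 'rV[R]_n -> R) (P : pred {set 'I_n}).

Lemma continuous_borel_measurable H : continuous H -> borel_measurable H.
Proof.
move=> /continuousP cH.
apply: (measurability _ (measurable_realfun.RGenOpens.measurableE R)).
move=> _ [_ [a [b ->] <-]]; rewrite setTI; apply: sub_sigma_algebra.
exact/cH/interval_open.
Qed.

(** The probability that [A] is the set of indices where independent copies of a
    variable exceed a level below which the variable lies with probability
    [p]. *)
Definition bernoulli_weight (A : {set 'I_n}) (p : R) : R :=
  \prod_i (if i \in A then 1 - p else p).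

Definition lower_mass P (p : R) : R := \sum_(A | ~~ P A) bernoulli_weight A p.

Lemma lower_mass_itv P p : 0 <= p <= 1 -> 0 <= lower_mass P p <= 1.
Proof.
move=> /andP[p0 p1].
have w0 A : 0 <= bernoulli_weight A p.
  by apply: prodr_ge0 => i _; case: ifP => // _; rewrite subr_ge0.
rewrite sumr_ge0//= (@le_trans _ _ (\sum_A bernoulli_weight A p))//.
  by rewrite [leRHS](bigID P)/= lerDr sumr_ge0.
(* The total weight is the expansion of the product of the (1 - p) + p. *)
rewrite -bigA_distr big1// => i _; exact: subrK.
Qed.

Lemma iid_exceed d0 (T0 : measurableType d0) (P0 : probability T0 R)
    (X : {RV P0 >-> R}) d (T : measurableType d) (Q : probability T R)
    (Xs : 'I_n -> {RV Q >-> R}) t (A : {set 'I_n}) :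
  independent_copies X Xs ->
  let E := [set w | exceed (\row_i Xs i w) t = A] in
  measurable E /\
  Q E = (bernoulli_weight A (fine (P0 [set w | X w <= t])))%:E.
Proof.
move=> [indep same] E.
pose B i : set R := if i \in A then `]t, +oo[ else `]-oo, t].
have mB i : measurable (B i) by rewrite /B; case: ifP.
have EB : E = \bigcap_(i in [set` [set: 'I_n]%SET]) (Xs i @^-1` B i).
  apply/seteqP; split=> w /=.
    move=> EA i _; rewrite /B -EA inE mxE /=.
    by case: ltP => h; rewrite /= in_itv /= ?h //.
  move=> wB; apply/setP => i; rewrite inE mxE.
  have /= := wB i; rewrite inE /B => /(_ isT).
  by case: ifP => _; rewrite /= in_itv/= ?andbT // leNgt => /negbTE.
split.
  rewrite EB; apply: fin_bigcap_measurable => // i _.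
  exact: measurable_funPTI.
rewrite EB indep//.
have leE : [set w | X w <= t] = X @^-1` `]-oo, t].
  by apply/seteqP; split=> w /=; rewrite in_itv.
have gtE : ~` [set w | X w <= t] = X @^-1` `]t, +oo[.
  by apply/seteqP; split=> w /=; rewrite in_itv/= andbT ltNge => /negP.
have mX : measurable [set w | X w <= t].
  by rewrite leE; exact: measurable_funPTI.
set p := P0 _.
have pfin : p = (fine p)%:E by rewrite fineK// fin_num_measure.
have XB i : Q (Xs i @^-1` B i) = (if i \in A then 1 - fine p else fine p)%:E.
  rewrite -[LHS]/(distribution Q (Xs i) (B i)) same//.
  rewrite /distribution/= /pushforward/B.
  case: ifP => _; last by rewrite -leE.
  by rewrite -gtE EFinB -pfin probability_setC.
rewrite (eq_bigr _ (fun i _ => XB i)) prodEFin; congr (_%:E).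
by apply: eq_bigl => i; rewrite finset.in_setT.
Qed.

(** The event [H <= t] is the disjoint union, over the sets [A] that fail [P], of
    the events that the copies exceed [t] exactly on [A]. *)
Lemma level_rule_conservative H P : level_rule H P -> conservative_statistic H.
Proof.
move=> HP; split.
  by apply: continuous_borel_measurable; exact: level_rule_continuous HP.
exists (lower_mass P); split; first exact: lower_mass_itv.
move=> d0 T0 P0 X d T Q Xs copies t.
have EA A := iid_exceed t A copies.
set E := fun A : {set 'I_n} => [set w | exceed (\row_i Xs i w) t = A].
rewrite (_ : [set _ | _] = \bigcup_(A in [set A | ~~ P A]) E A); last first.
  apply/seteqP; split=> w /=; rewrite leNgt HP.
    by exists (exceed (\row_i Xs i w) t).
  by move=> [A PA EAw]; rewrite EAw.
rewrite measure_fin_bigcup; first last.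
- by move=> A _; have [] := EA A.
- by move=> A B _ _ [w [<- <-]].
- exact: finite_finset.
rewrite fsbig_finite /=; last exact: finite_finset.
rewrite /lower_mass -sumEFin -[RHS]big_filter.
rewrite (perm_big [seq A <- index_enum _ | ~~ P A]).
  by apply: eq_bigr => A _; have [] := EA A.
apply: uniq_perm; first exact: finmap.fset_uniq.
  by rewrite filter_uniq// index_enum_uniq.
move=> A; rewrite in_fset_set ?mem_filter ?mem_index_enum ?andbT; last first.
  exact: finite_finset.
by apply/idP/idP; rewrite inE.
Qed.

End Conservative.

(** * Uniform probability on a finite type *)

(** The point [x0] is carried along because measurable types are pointed while
    finite types may be empty. *)
Definition discrete (T : finType) (x0 : T) : Type := T.

Section Uniform.
Context (T : finType) (x0 : T).

HB.instance Definition _ := Finite.on (discrete x0).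
HB.instance Definition _ := isPointed.Build (discrete x0) x0.
HB.instance Definition _ := @isMeasurable.Build default_measure_display
  (discrete x0) discrete_measurable discrete_measurable0
  discrete_measurableC discrete_measurableU.

Context (R : realType).

Definition uniform : set (discrete x0) -> \bar R :=
  mscale (#|T|%:R^-1)%:nng
    (msum (fun k => \d_(nth x0 (enum T) k : discrete x0)) #|T|).

HB.instance Definition _ := Measure.on uniform.

Lemma uniformE (A : set (discrete x0)) :
  uniform A = (#|[pred w : T | w \in A]|%:R / #|T|%:R)%:E.
Proof.
rewrite /uniform /mscale /= /msum /= mulrC EFinM; congr (_ * _)%E.
under eq_bigr do rewrite diracE.
rewrite sumEFin -natr_sum; congr (_%:R%:E).
rewrite -[RHS]sum1_card [RHS]big_mkcond -[RHS]big_enum.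
rewrite (big_nth x0) -cardE big_mkord.
by apply: eq_bigr => k _; rewrite inE; case: (_ \in A).
Qed.

Lemma uniform_setT : uniform setT = 1%E.
Proof.
rewrite uniformE (eq_card (B := T)) => [|w]; last by rewrite !inE in_setT.
by rewrite divff// pnatr_eq0 -lt0n; apply/card_gt0P; exists x0.
Qed.

HB.instance Definition _ :=
  @Measure_isProbability.Build _ _ R uniform uniform_setT.

End Uniform.
Arguments uniform {T} x0 R.

(** * Conservative statistics pick a coordinate *)

Section Resampling.
Context (R : realType) (n : nat).

(** An outcome draws one index for each of the copies.  The dimension is
    positive, since there is nothing to draw from otherwise. *)
Definition index_draws : finType := {ffun 'I_n.+1 -> 'I_n.+1}.
(** The draw that reproduces the original vector. *)
Definition draw0 : index_draws := [ffun i => i].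

Definition resample (x : 'rV[R]_n.+1) (i : 'I_n.+1) (w : discrete draw0) : R :=
  x ord0 ((w : index_draws) i).

Lemma measurable_resample x i : measurable_fun setT (resample x i).
Proof. by []. Qed.

HB.instance Definition _ x i :=
  isMeasurableFun.Build _ _ _ _ (resample x i) (measurable_resample x i).

Lemma uniform_cylinder (C : 'I_n.+1 -> {pred 'I_n.+1}) :
  uniform draw0 R [set w | forall i, (w : index_draws) i \in C i] =
  (\prod_i (#|C i|%:R / n.+1%:R))%:E.
Proof.
rewrite uniformE prodf_div -natr_prod; congr (_%:R / _)%:E.
  rewrite (eq_card (B := family C)) => [|w].
    by rewrite card_family foldrE big_map big_enum.
  by rewrite inE; apply/idP/familyP => [/set_mem|?]; [|exact: mem_set].
by rewrite card_ffun card_ord prodr_const card_ord natrX.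
Qed.

(** The indices outside [J] are unconstrained and contribute factors 1. *)
Lemma resample_law x (J : {set 'I_n.+1}) (B : 'I_n.+1 -> set R) :
  uniform draw0 R (\bigcap_(i in [set` J]) (resample x i @^-1` B i)) =
  (\prod_(i in J) (#|[pred k | x ord0 k \in B i]|%:R / n.+1%:R))%:E.
Proof.
pose C i : {pred 'I_n.+1} := [pred k | (i \in J) ==> (x ord0 k \in B i)].
rewrite (_ : \bigcap_(i in _) _ =
  [set w | forall i, (w : index_draws) i \in C i]).
  rewrite uniform_cylinder [in RHS]big_mkcond; congr (_%:E).
  apply: eq_bigr => i _; case: ifP => iJ.
    by congr (_%:R / _); apply: eq_card => k; rewrite !inE iJ.
  rewrite (eq_card (B := 'I_n.+1)) ?card_ord ?divff ?pnatr_eq0// => k.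
  by rewrite !inE iJ.
apply/seteqP; split=> w /= wB i.
  by rewrite inE; apply/implyP => iJ; apply: mem_set; exact: wB.
by move=> iJ; have := wB i; rewrite inE iJ => /set_mem.
Qed.

Lemma resample_iid (x : 'rV[R]_n.+1) :
  independent_copies (P0 := uniform draw0 R) (P := uniform draw0 R)
    (resample x ord0) (fun i => resample x i).
Proof.
have law1 i B : uniform draw0 R (resample x i @^-1` B) =
    (#|[pred k | x ord0 k \in B]|%:R / n.+1%:R)%:E.
  have := resample_law x [set i]%SET (fun=> B); rewrite big_set1 => <-.
  congr (uniform _ _ _); apply/seteqP; split=> w /= wB.
    by move=> j /=; rewrite inE => /eqP ->.
  by apply: (wB i); rewrite /= inE.
split=> [J B _|i B _].
  rewrite [LHS]resample_law -prodEFin; apply: eq_bigr => i _.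
  exact/esym/law1.
exact: etrans (law1 _ _) (esym (law1 _ _)).
Qed.

(** If [H x] were not a coordinate of [x], a slightly smaller level [u] would be
    equivalent to it for the resampled variable, so [H <= u] and [H <= H x]
    would be equally likely.  The draw that returns [x] is in the second event
    only. *)
Lemma conservative_coord (H : 'rV[R]_n.+1 -> R) : conservative_statistic H ->
  forall x, exists i, H x = x ord0 i.
Proof.
move=> [_ [h [_ Hh]]] x; apply: coord_of_exceed_jump => u ut.
apply/eqP => ux.
have hH t := Hh _ _ _ _ _ _ _ _ (resample_iid x) t.
have same : [set w | resample x ord0 w <= u] =
    [set w | resample x ord0 w <= H x].
  apply/seteqP; split=> w /=; rewrite !leNgt;
    by move/setP/(_ ((w : index_draws) ord0)) : ux; rewrite !inE => ->.
have := hH u; rewrite same -hH /= !uniformE => -[].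
have N0 : #|index_draws|%:R != 0 :> R.
  by rewrite pnatr_eq0 -lt0n; apply/card_gt0P; exists draw0.
move/(mulIf (invr_neq0 N0))/eqP; rewrite eqr_nat => /eqP card_eq.
have xdraw0 : \row_i resample x i draw0 = x.
  by apply/rowP => i; rewrite mxE /resample ffunE.
pose below t : {pred index_draws} :=
  [pred w | w \in [set w | H (\row_i resample x i w) <= t]].
suff : (#|below u| < #|below (H x)|)%N by rewrite card_eq ltnn.
apply/proper_card/properP; split.
  apply/fintype.subsetP => w; rewrite !inE /= => Hw.
  exact: le_trans Hw (ltW ut).
exists draw0; first by rewrite !inE /= xdraw0.
by apply/negP; rewrite !inE /= xdraw0 leNgt ut.
Qed.
End Resampling.

Theorem theorem4p10 (R : realType) (n : nat) (hn : (1 <= n)%N)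
    (H : 'rV[R]_n -> R) :
  ((continuous H /\ conservative_statistic H) <-> selector H) /\
  (selector H <-> sperner_statistic H).
Proof.
split; split.
- case=> cH sH; split=> //; case: n hn H cH sH => // n _ H _.
  exact: conservative_coord.
- move=> sH; split; first by case: sH.
  exact: level_rule_conservative (selector_level_rule sH).
- by move/selector_level_rule; exact: level_rule_sperner.
- by move=> /sperner_level_rule[P HP]; exact: level_rule_selector HP.
Qed.
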